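(* Let $G=(V,E)$ be a connected, locally finite infinite network with conductance function $c$ and base point $o\in V$, with energy Hilbert space $\mathscr{H}_E$ and dipoles $(v_x)_{x\in V}$. Let $(X_x)_{x\in V}$ be the corresponding Gaussian free field, i.e. with correlation $\mathbb{E}(X_xX_y)=k^{(c)}(x,y)=\langle v_x,v_y\rangle_{\mathscr{H}_E}$, and let $R^{(c)}$ be the corresponding resistance metric on $V$. Then $$\mathbb{E}(X_xX_z)+\mathbb{E}(X_zX_y)\le\mathbb{E}(X_xX_y)+R^{(c)}(o,z)$$ holds for all vertices $x,y,z\in V$.
   Context: Setting. $V$ is a countably infinite set, $E\subset V\times V\setminus(\text{diagonal})$ is symmetric, and $c:E\to(0,\infty)$ satisfies $c_{xy}=c_{yx}$. Each $x\in V$ has only finitely many neighbors (points $y$ with $(x,y)\in E$). A base point $o\in V$ is fixed, and $G$ is connected: for every $x\in V\setminus\{o\}$ there are edges $(x_i,x_{i+1})\in E$, $0\le i\le n-1$, with $x_0=o$, $x_n=x$. The energy Hilbert space $\mathscr{H}_E$ consists of all functions $f:V\to\mathbb{C}$ with $f(o)=0$ and $\|f\|_{\mathscr{H}_E}^2=\frac12\sum_{(x,y)\in E}c_{xy}|f(x)-f(y)|^2<\infty$, with inner product $\langle h,f\rangle_{\mathscr{H}_E}=\frac12\sum_{(x,y)\in E}c_{xy}(\overline{h(x)}-\overline{h(y)})(f(x)-f(y))$. For each $x\in V$ the dipole $v_x\in\mathscr{H}_E$ is the unique vector with $\langle v_x,f\rangle_{\mathscr{H}_E}=f(x)-f(o)$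 for all $f\in\mathscr{H}_E$ (so $v_o=0$). The resistance metric is $R^{(c)}(x,y)=\|v_x-v_y\|_{\mathscr{H}_E}^2$. A Gaussian free field associated with $(G,c,o)$ is a real Gaussian process $(X_x)_{x\in V}$ on a probability space such that every finite subfamily is jointly Gaussian (possibly degenerate), with $\mathbb{E}(X_x)=0$ and $\mathbb{E}(X_xX_y)=k^{(c)}(x,y)$ for all $x,y\in V$. *)

(* Defs.v *)
From HB Require Import structures.
From mathcomp Require Import all_boot all_order all_algebra.
From mathcomp Require Import all_classical all_reals all_analysis.
From mathcomp Require Import complex.

Set Implicit Arguments.
Unset Strict Implicit.
Unset Printing Implicit Defensive.

Import Order.TTheory GRing.Theory Num.Theory.
Import numFieldNormedType.Exports.

Local Open Scope classical_set_scope.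
Local Open Scope ring_scope.
Local Open Scope complex_scope.

(* The edge set E consists of ordered pairs. The conductance c is a total
   function, but it is constrained, and used, on E only. *)
Record network (R : realType) (V : countType) (E : set (V * V))
    (c : V -> V -> R) (o : V) : Prop := Network {
  vertices_infinite : infinite_set [set: V] ;
  edges_irrefl : forall x, ~ E (x, x) ;
  edges_sym : forall x y, E (x, y) -> E (y, x) ;
  conductance_gt0 : forall x y, E (x, y) -> 0 < c x y ;
  conductance_sym : forall x y, E (x, y) -> c x y = c y x ;
  locally_finite : forall x, finite_set [set y | E (x, y)] ;
  connected_network : forall x, x <> o ->
    exists (n : nat) (p : nat -> V),
      [/\ p 0%N = o, p n = x & forall i, (i < n)%N -> E (p i, p i.+1)] }.

(* The library's esum is only meaningful for nonnegative terms. The sum of an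
   absolutely summable real family is therefore taken to be the difference of
   the sums of its positive and negative parts, and a complex family is summed
   through its real and imaginary parts. *)
Definition real_sum (R : realType) (I : choiceType) (D : set I)
    (a : I -> R) : R :=
  fine (\esum_(i in D) (Num.max (a i) 0)%:E) -
  fine (\esum_(i in D) (Num.max (- a i) 0)%:E).

Definition complex_sum (R : realType) (I : choiceType) (D : set I)
    (a : I -> R[i]) : R[i] :=
  real_sum D (fun i => complex.Re (a i)) +i* real_sum D (fun i => complex.Im (a i)).

Definition energy_norm2 (R : realType) (V : countType) (E : set (V * V))
    (c : V -> V -> R) (f : V -> R[i]) : \bar R :=
  ((2^-1)%:E * \esum_(e in E)
     (c e.1 e.2 * ComplexField.Normc.normc (f e.1 - f e.2) ^+ 2)%:E)%E.

Definition energy_space (R : realType) (V : countType) (E : set (V * V))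
    (c : V -> V -> R) (o : V) : set (V -> R[i]) :=
  [set f | f o = 0 /\ (energy_norm2 E c f < +oo)%E].

(* For h and f in the energy space the family below is absolutely summable, by
   the Cauchy-Schwarz inequality. *)
Definition energy_inner (R : realType) (V : countType) (E : set (V * V))
    (c : V -> V -> R) (h f : V -> R[i]) : R[i] :=
  2^-1 * complex_sum E (fun e =>
    (c e.1 e.2)%:C * ((h e.1)^* - (h e.2)^*) * (f e.1 - f e.2)).

(* This determines v uniquely, and such a v exists by the Riesz representation
   theorem. *)
Definition is_dipole (R : realType) (V : countType) (E : set (V * V))
    (c : V -> V -> R) (o x : V) (v : V -> R[i]) : Prop :=
  energy_space E c o v /\
  forall f, energy_space E c o f -> energy_inner E c v f = f x - f o.

Definition dipole_kernel (R : realType) (V : countType) (E : set (V * V))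
    (c : V -> V -> R) (v : V -> V -> R[i]) (x y : V) : R[i] :=
  energy_inner E c (v x) (v y).

Definition resistance (R : realType) (V : countType) (E : set (V * V))
    (c : V -> V -> R) (v : V -> V -> R[i]) (x y : V) : R :=
  fine (energy_norm2 E c (v x \- v y)).

(* The normal law with deviation s = 0 is the point mass at its mean; it is
   listed separately because normal_prob m 0 is the uniform law on [0, 1]. *)
Definition gaussian (R : realType) d (T : measurableType d)
    (P : probability T R) (Y : T -> R) : Prop :=
  (exists m : R, forall A : set R, measurable A ->
     P (Y @^-1` A) = \d_m A) \/
  (exists m s : R, 0 < s /\ forall A : set R, measurable A ->
     P (Y @^-1` A) = normal_prob m s A).

Definition jointly_gaussian (R : realType) d (T : measurableType d)
    (P : probability T R) (n : nat) (Y : 'I_n -> {RV P >-> R}) : Prop :=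
  forall a : 'I_n -> R, gaussian P (fun w => \sum_(i < n) a i * Y i w).

Record gaussian_free_field (R : realType) (V : countType) (E : set (V * V))
    (c : V -> V -> R) (v : V -> V -> R[i])
    d (T : measurableType d) (P : probability T R) (X : V -> {RV P >-> R}) :
    Prop := GaussianFreeField {
  gff_gaussian : forall (n : nat) (p : 'I_n -> V),
    jointly_gaussian (fun i => X (p i)) ;
  gff_mean : forall x, ('E_P[X x] = 0)%E ;
  (* The kernel is complex valued, so the correlation is embedded in R[i]. *)
  gff_correlation : forall x y,
    ('E_P[X x \* X y])%E \is a fin_num /\
    (fine 'E_P[X x \* X y]%E)%:C = dipole_kernel E c v x y }.

(* Main.v *)
Require Import Defs.
From mathcomp Require Import all_boot all_order all_algebra.
From mathcomp Require Import all_classical all_reals all_analysis.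
From mathcomp Require Import complex.
From mathcomp Require Import ring lra.

(** Since R(o,z) = k(z,z), the inequality says that <v_x - v_z, v_y - v_z> is
    nonnegative. By the reproducing property of v_x and v_z, this means that
    the potential F = Re (v_y - v_z) satisfies F(z) <= F(x): F attains its
    minimum at z ([dipole_difference_minimum]).

    The minimum principle follows by truncation. Let t = min(F, F(z)). Along
    every edge (a,b), (t(a) - t(b))^2 <= (F(a) - F(b)) (t(a) - t(b)), so t
    shifted to vanish at o has finite energy, and <v_y - v_z, t> is a sum of
    nonnegative terms. On the other hand the reproducing property gives
    <v_y - v_z, t> = t(y) - t(z) = min(F(y), F(z)) - F(z) <= 0. Hence every
    term vanishes and t takes the same value at both ends of each edge. Then t,
    so shifted, is orthogonal to every dipole v_w, so t(w) = t(o) for all w, and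
    min(F(x), F(z)) = t(x) = t(z) = F(z), as required.

    The dipoles are complex valued, and the argument is carried out on the real
    part of the inner product: paired with a real function, it depends only on
    the real part of v_y - v_z. That <v_y - v_z, t> splits as the difference of
    <v_y, t> and <v_z, t> rests on [real_sumB], the compatibility of sums with
    differences of absolutely summable families. *)

Set Implicit Arguments.
Unset Strict Implicit.

Import Order.TTheory GRing.Theory Num.Theory.

Local Open Scope classical_set_scope.
Local Open Scope ring_scope.

(** * Sums of absolutely summable real families *)

Lemma summable_dominated (R : realType) (I : choiceType) (D : set I)
    (a b : I -> R) :
  (forall i, D i -> `|a i| <= b i) ->
  summable D (EFin \o b) -> summable D (EFin \o a).
Proof.
move=> ab; apply: le_lt_trans; apply: le_esum => i Di /=.
by rewrite lee_fin (le_trans (ab _ Di))// ler_norm.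
Qed.

Lemma esum_nonneg_fin_num (R : realType) (I : choiceType) (D : set I)
    (a : I -> R) :
  (forall i, D i -> 0 <= a i) -> summable D (EFin \o a) ->
  (\esum_(i in D) (a i)%:E)%E \is a fin_num.
Proof.
move=> a0; rewrite summableE; congr (_ \is a fin_num).
by apply: eq_esum => i Di /=; rewrite ger0_norm// a0.
Qed.

Lemma real_sum_nonneg (R : realType) (I : choiceType) (D : set I) (a : I -> R) :
  (forall i, D i -> 0 <= a i) ->
  real_sum D a = fine (\esum_(i in D) (a i)%:E).
Proof.
move=> a0; rewrite /real_sum [X in _ - fine X]esum1 ?subr0; last first.
  by move=> i Di; rewrite max_r// oppr_le0 a0.
by congr fine; apply: eq_esum => i Di; rewrite max_l// a0.
Qed.

Lemma eq_real_sum (R : realType) (I : choiceType) (D : set I) (a b : I -> R) :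
  (forall i, D i -> a i = b i) -> real_sum D a = real_sum D b.
Proof.
by move=> ab; congr (fine _ - fine _); apply: eq_esum => i Di; rewrite ab.
Qed.

Lemma real_sumB_nonneg (R : realType) (I : choiceType) (D : set I)
    (p q : I -> R) :
  (forall i, D i -> 0 <= p i) -> (forall i, D i -> 0 <= q i) ->
  summable D (EFin \o p) -> summable D (EFin \o q) ->
  real_sum D (fun i => p i - q i) = real_sum D p - real_sum D q.
Proof.
move=> p0 q0 sp sq.
have finpart : [/\ (\esum_(i in D) (Num.max (p i - q i) 0)%:E)%E \is a fin_num
    & (\esum_(i in D) (Num.max (- (p i - q i)) 0)%:E)%E \is a fin_num].
  (* The two parts of p - q are dominated by p and by q respectively. *)
  split; apply: esum_nonneg_fin_num;
    try by move=> i Di; rewrite le_max lexx orbT.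
  - apply: summable_dominated sp => i Di; have := p0 _ Di; have := q0 _ Di.
    by move=> ? ?; rewrite ger0_norm ?le_max ?lexx ?orbT// ge_max; lra.
  - apply: summable_dominated sq => i Di; have := p0 _ Di; have := q0 _ Di.
    by move=> ? ?; rewrite ger0_norm ?le_max ?lexx ?orbT// ge_max; lra.
case: finpart => fpos fneg.
rewrite (@real_sum_nonneg _ _ _ p)// (@real_sum_nonneg _ _ _ q)//.
have fp := esum_nonneg_fin_num p0 sp; have fq := esum_nonneg_fin_num q0 sq.
rewrite /real_sum -!fineB//; congr fine.
rewrite -(esumB sp sq p0 q0); congr (_ - _)%E; apply: eq_esum => i _.
- by rewrite funeposE -EFin_max.
- by rewrite funenegE -EFin_max.
Qed.

Lemma real_sumD_nonneg (R : realType) (I : choiceType) (D : set I)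
    (p q : I -> R) :
  (forall i, D i -> 0 <= p i) -> (forall i, D i -> 0 <= q i) ->
  summable D (EFin \o p) -> summable D (EFin \o q) ->
  real_sum D (fun i => p i + q i) = real_sum D p + real_sum D q.
Proof.
move=> p0 q0 sp sq.
have := @real_sumB_nonneg R I D (fun i => p i + q i) q.
rewrite (@eq_real_sum R I D _ p); last by move=> i _; rewrite addrK.
move=> ->//; first by rewrite subrK.
- by move=> i Di; rewrite addr_ge0 ?p0 ?q0.
- exact: (summableD sp sq).
Qed.

Lemma real_sumB (R : realType) (I : choiceType) (D : set I) (a b : I -> R) :
  summable D (EFin \o a) -> summable D (EFin \o b) ->
  real_sum D (fun i => a i - b i) = real_sum D a - real_sum D b.
Proof.
move=> sa sb.
pose pos (r : I -> R) i := Num.max (r i) 0.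
pose neg (r : I -> R) i := Num.max (- r i) 0.
have pos0 r i : D i -> 0 <= pos r i by rewrite le_max lexx orbT.
have neg0 r i : D i -> 0 <= neg r i by rewrite le_max lexx orbT.
have spos r : summable D (EFin \o r) -> summable D (EFin \o pos r).
  by apply: le_lt_trans; apply: le_esum => i Di /=;
     rewrite lee_fin ger0_norm ?pos0// /pos ge_max ler_norm normr_ge0.
have sneg r : summable D (EFin \o r) -> summable D (EFin \o neg r).
  by apply: le_lt_trans; apply: le_esum => i Di /=;
     rewrite lee_fin ger0_norm ?neg0// /neg ge_max -normrN ler_norm normr_ge0.
have posneg r i : r i = pos r i - neg r i.
  by rewrite /pos /neg /Num.max; do 2 case: ltP => ?; lra.
have sD (r s : I -> R) : summable D (EFin \o r) -> summable D (EFin \o s) ->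
    summable D (EFin \o (fun i => r i + s i)) by exact: summableD.
(* a - b = (a^+ + b^-) - (a^- + b^+) is a difference of nonnegative families. *)
rewrite (@eq_real_sum R I D _
  (fun i => (pos a i + neg b i) - (neg a i + pos b i))); last first.
  by move=> i _; rewrite [LHS](_ : _ = (pos a i - neg a i) - (pos b i - neg b i));
     [ring|rewrite -!posneg].
rewrite [real_sum D a](@eq_real_sum R I D _ (fun i => pos a i - neg a i));
  last by move=> i _; exact: posneg.
rewrite [real_sum D b](@eq_real_sum R I D _ (fun i => pos b i - neg b i));
  last by move=> i _; exact: posneg.
rewrite !real_sumB_nonneg ?real_sumD_nonneg; auto; try ring.
- by move=> i Di; rewrite addr_ge0 ?pos0 ?neg0.
- by move=> i Di; rewrite addr_ge0 ?pos0 ?neg0.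
Qed.

Lemma real_sum_le0_eq0 (R : realType) (I : choiceType) (D : set I)
    (a : I -> R) :
  (forall i, D i -> 0 <= a i) -> summable D (EFin \o a) ->
  real_sum D a <= 0 -> forall i, D i -> a i = 0.
Proof.
move=> a0 sa; rewrite real_sum_nonneg// => s0 i Di.
apply/eqP; rewrite eq_le a0// andbT; apply: le_trans s0.
rewrite -lee_fin fineK ?esum_nonneg_fin_num//; apply: esum_ge; exists [set i].
  by split; [exact: finite_set1|move=> _ ->].
by rewrite fsbig_set1.
Qed.

(** * The real part of the energy inner product *)

(** The contribution of the edge [e] to twice the real part of the inner
    product of [h] and [f]. *)
Definition edge_term (R : realType) (V : countType) (c : V -> V -> R)
    (h f : V -> R[i]) (e : V * V) : R :=
  c e.1 e.2 * (complex.Re (h e.1 - h e.2) * complex.Re (f e.1 - f e.2)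
             + complex.Im (h e.1 - h e.2) * complex.Im (f e.1 - f e.2)).

(** The real part of the energy inner product of [h] and [f]. *)
Definition re_inner (R : realType) (V : countType) (E : set (V * V))
    (c : V -> V -> R) (h f : V -> R[i]) : R :=
  complex.Re (energy_inner E c h f).

Lemma re_innerE (R : realType) (V : countType) (E : set (V * V))
    (c : V -> V -> R) (h f : V -> R[i]) :
  re_inner E c h f = 2^-1 * real_sum E (edge_term c h f).
Proof.
rewrite /re_inner /energy_inner.
have -> : 2^-1 = real_complex R 2^-1 by rewrite fmorphV rmorph_nat.
rewrite /= mul0r subr0; congr (_ * _); apply: eq_real_sum => -[x y] _.
rewrite /edge_term /=.
by case: (h x) (h y) (f x) (f y) => [? ?] [? ?] [? ?] [? ?] /=; ring.
Qed.

Lemma edge_term_normc (R : realType) (V : countType) (c : V -> V -> R)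
    (f : V -> R[i]) (e : V * V) :
  c e.1 e.2 * ComplexField.Normc.normc (f e.1 - f e.2) ^+ 2 = edge_term c f f e.
Proof.
rewrite /edge_term; case: (f e.1 - f e.2) => a b /=.
by rewrite sqr_sqrtr ?addr_ge0 ?sqr_ge0.
Qed.

Lemma edge_term_ge0 (R : realType) (V : countType) (E : set (V * V))
    (c : V -> V -> R) (f : V -> R[i]) :
  (forall x y, E (x, y) -> 0 < c x y) ->
  forall e, E e -> 0 <= edge_term c f f e.
Proof.
move=> c0 [x y] /c0 cxy.
by rewrite mulr_ge0 ?(ltW cxy)// addr_ge0 -?expr2 ?sqr_ge0.
Qed.

Lemma energy_norm2_summable (R : realType) (V : countType) (E : set (V * V))
    (c : V -> V -> R) (f : V -> R[i]) :
  (forall x y, E (x, y) -> 0 < c x y) ->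
  (energy_norm2 E c f < +oo)%E <-> summable E (EFin \o edge_term c f f).
Proof.
move=> c0; rewrite /energy_norm2 /summable.
rewrite (@eq_esum _ _ _ _ (fun e => `|(EFin \o edge_term c f f) e|)%E); last first.
  by move=> e Ee /=; rewrite edge_term_normc ger0_norm// (@edge_term_ge0 _ _ E).
have : (0 <= \esum_(e in E) `|(EFin \o edge_term c f f) e|)%E.
  by apply: esum_ge0 => e _; exact: abse_ge0.
case: (\esum_(e in E) _)%E => [r| |] //= _; first by rewrite !ltry.
by rewrite gt0_muley// lte_fin invr_gt0.
Qed.

(** By the arithmetic-geometric mean inequality, the edge terms of the pair h, f
    are dominated by the sum of those of h, h and of f, f. *)
Lemma edge_term_summable (R : realType) (V : countType) (E : set (V * V))
    (c : V -> V -> R) (h f : V -> R[i]) :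
  (forall x y, E (x, y) -> 0 < c x y) ->
  (energy_norm2 E c h < +oo)%E -> (energy_norm2 E c f < +oo)%E ->
  summable E (EFin \o edge_term c h f).
Proof.
move=> c0 /(energy_norm2_summable _ c0) sh
  /(energy_norm2_summable _ c0) sf.
apply: summable_dominated (summableD sh sf) => -[x y] /c0 cxy /=.
rewrite /edge_term /= normrM gtr0_norm// -mulrDr ler_pM2l//.
set a := complex.Re _; set b := complex.Re _.
set a' := complex.Im _; set b' := complex.Im _.
rewrite ler_norml.
have := sqr_ge0 (a + b); have := sqr_ge0 (a - b).
have := sqr_ge0 (a' + b'); have := sqr_ge0 (a' - b').
by have := sqr_ge0 a; have := sqr_ge0 b; have := sqr_ge0 a';
   have := sqr_ge0 b'; move=> *; apply/andP; split; lra.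
Qed.

Lemma energy_norm2B_lty (R : realType) (V : countType) (E : set (V * V))
    (c : V -> V -> R) (h f : V -> R[i]) :
  (forall x y, E (x, y) -> 0 < c x y) ->
  (energy_norm2 E c h < +oo)%E -> (energy_norm2 E c f < +oo)%E ->
  (energy_norm2 E c (h \- f)%R < +oo)%E.
Proof.
move=> c0 /(energy_norm2_summable _ c0) sh
  /(energy_norm2_summable _ c0) sf.
apply/energy_norm2_summable => //.
have s := summableD sh sf.
apply: summable_dominated (summableD s s) => -[x y] Exy.
rewrite ger0_norm ?(@edge_term_ge0 _ _ E)//= /edge_term /= -!mulrDr ler_pM2l ?c0//.
case: (h x) (h y) (f x) (f y) => [p p'] [q q'] [r r'] [s0 s'] /=.
set a := p - q; set b := r - s0; set a' := p' - q'; set b' := r' - s'.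
have -> : p - r - (q - s0) = a - b by rewrite /a /b; ring.
have -> : p' - r' - (q' - s') = a' - b' by rewrite /a' /b'; ring.
by have := sqr_ge0 (a + b); have := sqr_ge0 (a' + b'); lra.
Qed.

Lemma energy_norm2_re_inner (R : realType) (V : countType) (E : set (V * V))
    (c : V -> V -> R) (f : V -> R[i]) :
  (forall x y, E (x, y) -> 0 < c x y) -> (energy_norm2 E c f < +oo)%E ->
  fine (energy_norm2 E c f) = re_inner E c f f.
Proof.
move=> c0 /(energy_norm2_summable _ c0); rewrite summableE => ff.
rewrite re_innerE real_sum_nonneg; last by move=> e Ee; exact: (@edge_term_ge0 _ _ E).
rewrite /energy_norm2 fineM//.
  congr (_ * fine _); apply: eq_esum => e Ee; congr EFin.
  exact: edge_term_normc.
move: ff; congr (_ \is a fin_num); apply: eq_esum => e Ee /=.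
by rewrite edge_term_normc ger0_norm// (@edge_term_ge0 _ _ E).
Qed.

Lemma re_innerC (R : realType) (V : countType) (E : set (V * V))
    (c : V -> V -> R) (h f : V -> R[i]) :
  re_inner E c h f = re_inner E c f h.
Proof.
rewrite !re_innerE; congr (_ * _); apply: eq_real_sum => e _.
by rewrite /edge_term mulrC [X in X * _]addrC mulrC addrC
  ![complex.Re (f _ - _) * _]mulrC ![complex.Im (f _ - _) * _]mulrC.
Qed.

Lemma re_innerBl (R : realType) (V : countType) (E : set (V * V))
    (c : V -> V -> R) (g h f : V -> R[i]) :
  (forall x y, E (x, y) -> 0 < c x y) ->
  (energy_norm2 E c g < +oo)%E -> (energy_norm2 E c h < +oo)%E ->
  (energy_norm2 E c f < +oo)%E ->
  re_inner E c (g \- h)%R f = re_inner E c g f - re_inner E c h f.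
Proof.
move=> c0 fg fh ff; rewrite !re_innerE -mulrBr -real_sumB;
  [|exact: edge_term_summable..].
congr (_ * _); apply: eq_real_sum => -[x y] _; rewrite /edge_term /=.
by case: (g x) (g y) (h x) (h y) (f x) (f y) =>
  [? ?] [? ?] [? ?] [? ?] [? ?] [? ?] /=; ring.
Qed.

Lemma re_inner_edge_constant (R : realType) (V : countType) (E : set (V * V))
    (c : V -> V -> R) (h f : V -> R[i]) :
  (forall e, E e -> f e.1 = f e.2) -> re_inner E c h f = 0.
Proof.
move=> cf; rewrite re_innerE (_ : real_sum _ _ = 0) ?mulr0//.
rewrite real_sum_nonneg => [|e Ee]; first rewrite esum1// => e Ee; last first.
all: by rewrite /edge_term cf// subrr !mulr0 addr0 mulr0.
Qed.

Lemma re_inner_dipole (R : realType) (V : countType) (E : set (V * V))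
    (c : V -> V -> R) (o x : V) (v f : V -> R[i]) :
  is_dipole E c o x v -> energy_space E c o f ->
  re_inner E c v f = complex.Re (f x).
Proof.
by move=> [_ dip] sf; rewrite /re_inner dip//; case: sf => -> _; rewrite subr0.
Qed.

(** * The minimum principle *)

(** The real part of the potential of a unit current flow between y and z is
    minimal at its pole z. *)
Lemma dipole_difference_minimum (R : realType) (V : countType)
    (E : set (V * V)) (c : V -> V -> R) (o x y z : V)
    (vx vy vz : V -> R[i]) :
  (forall x y, E (x, y) -> 0 < c x y) ->
  is_dipole E c o x vx -> is_dipole E c o y vy -> is_dipole E c o z vz ->
  complex.Re (vy z - vz z) <= complex.Re (vy x - vz x).
Proof.
move=> c0 dx dy dz.
pose F w := complex.Re (vy w - vz w).
pose t w := Num.min (F w) (F z).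
(* The test function must vanish at the base point. *)
pose u w := real_complex R (t w - t o).
have [[_ fy] _] := dy; have [[_ fz] _] := dz.
have ff := energy_norm2B_lty c0 fy fz.
have uE a b : u a - u b = real_complex R (t a - t b).
  by rewrite /u -rmorphB opprB addrA subrK.
have tmul a b : (t a - t b) ^+ 2 <= (F a - F b) * (t a - t b).
  by rewrite /t /Num.min; do 2 case: ltP => ?; nra.
have tsq a b : (t a - t b) ^+ 2 <= (F a - F b) ^+ 2.
  by have := tmul a b; have := sqr_ge0 (F a - F b - (t a - t b)); lra.
have su : energy_space E c o u.
  split; first by rewrite /u subrr.
  apply/energy_norm2_summable => //.
  move/(energy_norm2_summable _ c0): ff.
  apply: summable_dominated => -[a b] Eab.
  rewrite ger0_norm ?(@edge_term_ge0 _ _ E)// /edge_term uE /= ler_pM2l ?c0//.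
  rewrite mulr0 addr0 -!expr2.
  have -> : complex.Re (vy a - vz a - (vy b - vz b)) = F a - F b.
    by rewrite [LHS]raddfB.
  by rewrite (le_trans (tsq _ _))// lerDl sqr_ge0.
have [_ fu] := su.
have termE e : edge_term c (vy \- vz)%R u e =
    c e.1 e.2 * ((F e.1 - F e.2) * (t e.1 - t e.2)).
  rewrite /edge_term uE /= mulr0 addr0; congr (_ * (_ * _)).
  by rewrite [LHS]raddfB.
have term0 : forall e, E e -> edge_term c (vy \- vz)%R u e = 0.
  apply: real_sum_le0_eq0.
  - move=> [a b] Eab; rewrite termE mulr_ge0 ?(ltW (c0 _ _ Eab))//=.
    by rewrite (le_trans _ (tmul _ _))// sqr_ge0.
  - exact: edge_term_summable.
  - have : re_inner E c (vy \- vz)%R u <= 0.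
      rewrite re_innerBl// (re_inner_dipole dy su).
      rewrite (re_inner_dipole dz su) /u /=.
      rewrite opprB addrA subrK subr_le0 /t minxx.
      by rewrite ge_min lexx orbT.
    by rewrite re_innerE pmulr_rle0// invr_gt0.
have uconst e : E e -> u e.1 = u e.2.
  case: e => a b Eab; apply/eqP; rewrite -subr_eq0 uE.
  have /eqP := term0 _ Eab; rewrite termE mulf_eq0 gt_eqF ?c0//= => /eqP Ft.
  have : (t a - t b) ^+ 2 == 0 by rewrite eq_le sqr_ge0 -Ft tmul.
  by rewrite sqrf_eq0 => /eqP ->.
(* As u is constant along edges, it is orthogonal to every dipole. *)
have ut w vw : is_dipole E c o w vw -> t w = t o.
  move=> dw; apply/eqP; rewrite -subr_eq0.
  have := re_inner_dipole dw su.
  by rewrite re_inner_edge_constant// /u /= => ->.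
have : t x = t z by rewrite (ut _ _ dx) (ut _ _ dz).
by rewrite /t minxx -[leLHS]/(F z) => <-; rewrite ge_min lexx.
Qed.

(** * The inequality for the Gaussian free field *)

Theorem corollary4p12 (R : realType) (V : countType) (E : set (V * V))
    (c : V -> V -> R) (o : V) (v : V -> V -> R[i])
    (d : measure_display) (T : measurableType d) (P : probability T R)
    (X : V -> {RV P >-> R}) :
  network E c o ->
  (forall x, is_dipole E c o x (v x)) ->
  gaussian_free_field E c v X ->
  forall x y z : V,
    ('E_P[X x \* X z] + 'E_P[X z \* X y]
       <= 'E_P[X x \* X y] + (resistance E c v o z)%:E)%E.
Proof.
move=> net dip gff x y z.
have c0 := conductance_gt0 net.
have sv w : energy_space E c o (v w) by case: (dip w).
have fv w : (energy_norm2 E c (v w) < +oo)%E by case: (sv w).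
have innerE a b : re_inner E c (v a) (v b) = complex.Re (v b a).
  exact: re_inner_dipole (dip a) (sv b).
have corrE a b : ('E_P[X a \* X b])%E = (complex.Re (v b a))%:E.
  have [fin k] := gff_correlation gff a b.
  rewrite -(fineK fin) -innerE /re_inner.
  by rewrite -[energy_inner _ _ _ _]/(dipole_kernel E c v a b) -k.
have resE : resistance E c v o z = complex.Re (v z z).
  have [vz0 _] := sv z.
  (* Every vector of the space vanishes at o, so v o is orthogonal to all. *)
  have voz : complex.Re (v o z) = 0 by rewrite -innerE re_innerC innerE vz0.
  have fB := energy_norm2B_lty c0 (fv o) (fv z).
  have [voo _] := sv o.
  have sB : energy_space E c o (v o \- v z)%R by split; rewrite //= voo vz0 subrr.
  rewrite /resistance energy_norm2_re_inner// re_innerBl//.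
  rewrite (re_inner_dipole (dip o) sB).
  rewrite (re_inner_dipole (dip z) sB) /= voo vz0 subrr.
  by rewrite [complex.Re (_ - _)]raddfB /= voz !sub0r opprK.
rewrite resE !corrE -!EFinD lee_fin.
have := dipole_difference_minimum c0 (dip x) (dip y) (dip z).
by rewrite !raddfB /=; lra.
Qed.
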